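(* The class $K^F$ is faithful: whenever $(\Gamma_1,X_1),(\Gamma_2,X_2)\in K^F$ and $\Phi\colon\Gamma_1\to\Gamma_2$ is an isomorphism of abstract groups, there exists a homeomorphism $\phi\colon X_1\to X_2$ such that $\Phi(\gamma)=\phi\circ\gamma\circ\phi^{-1}$ for every $\gamma\in\Gamma_1$.
   Context: A Boolean space is a Hausdorff space with a basis of compact open sets. For a space $X$, $\operatorname{supp}(\phi)$ is the closure of $\{x:\phi(x)\ne x\}$, and $\operatorname{Homeo}_c(X)$ is the set of homeomorphisms of $X$ whose support is compact and open. A space-group pair is $(\Gamma,X)$ with $X$ a Boolean space and $\Gamma$ a subgroup of $\operatorname{Homeo}(X)$ contained in $\operatorname{Homeo}_c(X)$. The class $K^F$ consists of all such pairs satisfying: (F1) for any $x\in X$ and clopen neighbourhood $A$ of $x$, there is $\alpha\in\Gamma\setminus\{1\}$ with $\alpha^2=1$, $x\in\operatorname{supp}(\alpha)$ and $\operatorname{supp}(\alpha)\subseteq A$; (F2) for any $\alpha\in\Gamma\setminus\{1\}$ with $\alpha^2=1$ and any non-empty clopen $A\subseteq\operatorname{supp}(\alpha)$, there is $\beta\in\Gamma\setminus\{1\}$ with $\operatorname{supp}(\beta)\subseteq A\cup\alpha(A)$ and $\alpha(x)=\beta(x)$ for all $x\in\operatorname{supp}(\beta)$; (F3) for any non-empty clopen $A\subseteq X$ there is $\alpha\in\Gamma$ with $\operatorname{supp}(\alpha)\subseteq A$ and $\alpha^2\ne1$. *)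

(* Defs.v *)
From HB Require Import structures.
From mathcomp Require Import all_boot all_order.
From mathcomp Require Import boolp classical_sets functions topology.
Set Implicit Arguments. Unset Strict Implicit. Unset Printing Implicit Defensive.
Local Open Scope classical_set_scope.

Definition boolean_space (T : topologicalType) : Prop :=
  hausdorff_space T /\
  forall (x : T) (U : set T), open U -> U x ->
    exists B : set T, [/\ compact B, open B, B x & B `<=` U].

Definition is_homeo (S T : topologicalType) (f : S -> T) : Prop :=
  continuous f /\
  exists g : T -> S, [/\ continuous g, cancel f g & cancel g f].

Definition supp (T : topologicalType) (f : T -> T) : set T :=
  closure [set x | f x <> x].

Definition homeo_c (T : topologicalType) (f : T -> T) : Prop :=
  [/\ is_homeo f, compact (supp f) & open (supp f)].

Definition homeo_subgroup (T : topologicalType) (G : set (T -> T)) : Prop :=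
  [/\ G id,
      (forall f g, G f -> G g -> G (f \o g)),
      (forall f, G f -> exists g, [/\ G g, f \o g = id & g \o f = id]) &
      (forall f, G f -> is_homeo f)].

Definition space_group_pair (T : topologicalType) (G : set (T -> T)) : Prop :=
  [/\ boolean_space T, homeo_subgroup G & G `<=` @homeo_c T].

Definition involution_nontriv (T : Type) (a : T -> T) : Prop :=
  a <> id /\ a \o a = id.

Definition F1 (T : topologicalType) (G : set (T -> T)) : Prop :=
  forall (x : T) (A : set T), clopen A -> A x ->
    exists a, [/\ G a, involution_nontriv a, supp a x & supp a `<=` A].

Definition F2 (T : topologicalType) (G : set (T -> T)) : Prop :=
  forall a, G a -> involution_nontriv a ->
  forall A : set T, clopen A -> A !=set0 -> A `<=` supp a ->
    exists b, [/\ G b, b <> id, supp b `<=` A `|` a @` A &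
                  forall x, supp b x -> a x = b x].

Definition F3 (T : topologicalType) (G : set (T -> T)) : Prop :=
  forall A : set T, clopen A -> A !=set0 ->
    exists a, [/\ G a, supp a `<=` A & a \o a <> id].

Definition in_KF (T : topologicalType) (G : set (T -> T)) : Prop :=
  [/\ space_group_pair G, F1 G, F2 G & F3 G].

(* Phi is an isomorphism of abstract groups from G1 onto G2
   (only its values on G1 matter) *)
Definition group_iso (T1 T2 : Type) (G1 : set (T1 -> T1)) (G2 : set (T2 -> T2))
    (Phi : (T1 -> T1) -> (T2 -> T2)) : Prop :=
  [/\ (forall g, G1 g -> G2 (Phi g)),
      (forall g h, G1 g -> G1 h -> Phi g = Phi h -> g = h),
      (forall h, G2 h -> exists2 g, G1 g & Phi g = h) &
      (forall g h, G1 g -> G1 h -> Phi (g \o h) = Phi g \o Phi h)].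

(* Main.v *)
(* For an involution [t] of [G], let [U] be the set of involutions [s]
   commuting with [t] and with every conjugate of [s] by the centralizer of
   [t].  By (F3), each [s] in [U] is supported in [supp t]; conversely [U]
   contains all [s] with [s x] in [{x, t x}] for every [x], hence by (F2) it is
   rich enough that any [a] centralizing [U] satisfies [a x] in [{x, t x}] on
   [supp t], so that [a \o a] is trivial there.  By (F3) again, the centralizer
   of these squares is exactly the set of [g] in [G] with [supp g] contained in
   [supp t].  Inclusion among supports of involutions is thus a group-theoretic
   relation, and by (F1) these supports form a basis of compact open sets.  The
   requirement that [x] lie in [supp t] exactly when [y] lies in [supp (Phi t)]
   therefore defines the graph of an equivariant homeomorphism. *)
Require Import Defs.
From mathcomp Require Import all_boot all_order.
From mathcomp Require Import boolp classical_sets functions topology.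
Set Implicit Arguments. Unset Strict Implicit. Unset Printing Implicit Defensive.
Local Open Scope classical_set_scope.

(** * Commuting self-maps *)

Definition commutes (T : Type) (f g : T -> T) : Prop := f \o g = g \o f.

Lemma commutesP (T : Type) (f g : T -> T) :
  commutes f g <-> forall x, f (g x) = g (f x).
Proof. by split=> [/funeqP//|fg]; apply/funext. Qed.

(** An injective map sends a point it moves to a point it moves; so if [f] moves [x], then [g] fixes
    both [x] and [f x]. *)
Lemma commutes_disjoint (T : Type) (f g : T -> T) :
  injective f -> injective g -> (forall x, f x = x \/ g x = x) -> commutes f g.
Proof.
move=> fI gI fg; apply/commutesP => x.
have [fx|fx] := pselect (f x = x).
  have [gx|gx] := pselect (g x = x); first by rewrite fx gx.
  by rewrite fx; case: (fg (g x)) => // /gI.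
case: (fg x) => // gx; rewrite gx; case: (fg (f x)) => [/fI//|->//].
Qed.

Lemma compK (S T : Type) (f : S -> T) (g : T -> S) :
  f \o g = id -> cancel g f.
Proof. by move=> /funeqP. Qed.

(* The map [d := s \o c \o s] fixes [B] pointwise and [c \o s \o c^-1] is
   [c \o d^-1 \o s].  It commutes with [s] only if [c \o d^-1], which [s]
   conjugates to [d \o c^-1], equals the latter; on [B] this reads
   [c = c^-1]. *)
Lemma commutes_conj_square (T : Type) (s c c' : T -> T) (B : set T) :
  s \o s = id -> c \o c' = id -> c' \o c = id ->
  commutes s (c \o s \o c') ->
  (forall y, c y <> y -> B y) -> (forall y, B y -> ~ B (s y)) ->
  c \o c = id.
Proof.
move=> /compK ss /compK cc' /compK c'c /commutesP/= sc cB Bs.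
have cI : injective c by apply: can_inj c'c.
have fixN y : ~ B y -> c y = y by move=> nB; apply: contrapT => /cB.
have fixN' y : ~ B y -> c' y = y by move=> /fixN cy; rewrite -{1}cy c'c.
apply/funext => y /=; apply: contrapT => ccy.
have cy : c y <> y by move=> cy; rewrite !cy in ccy.
have By := cB _ cy; have Bcy : B (c y) by apply: cB => /cI.
have := sc (c y); rewrite c'c fixN ?ss; last exact: Bs.
by rewrite fixN' ?ss => [/esym//|]; exact: Bs.
Qed.

(** * Supports and separation *)

Lemma nsupp_fix (T : topologicalType) (f : T -> T) (x : T) :
  ~ supp f x -> f x = x.
Proof. by move=> nfx; apply: contrapT => fx; apply/nfx/subset_closure. Qed.

Lemma supp_moved (T : topologicalType) (f : T -> T) (x : T) :
  f x <> x -> supp f x.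
Proof. by move=> fx; apply: subset_closure. Qed.

Lemma supp_sub (T : topologicalType) (f g : T -> T) :
  (forall x, f x <> x -> supp g x) -> supp f `<=` supp g.
Proof.
move=> fg x /(closureS fg); rewrite -(closure_id (supp g)).1 //.
exact: closed_closure.
Qed.

Lemma supp_nonempty (T : topologicalType) (f : T -> T) :
  f <> id -> supp f !=set0.
Proof.
move=> fid; apply: contrapT => f0; apply/fid/funext => x /=.
by apply: nsupp_fix => fx; apply: f0; exists x.
Qed.

Lemma supp_conj_sub (T : topologicalType) (f g h : T -> T) (x : T) :
  continuous h -> cancel h g -> supp (g \o f \o h) x -> supp f (h x).
Proof.
move=> ch hK sx B hB; have [y [/= gy By]] := sx _ (ch _ _ hB).
by exists (h y); split=> //= fhy; apply: gy; rewrite fhy hK.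
Qed.

Lemma supp_conj (T : topologicalType) (f g h : T -> T) (x : T) :
  continuous g -> continuous h -> cancel h g -> cancel g h ->
  supp (g \o f \o h) x <-> supp f (h x).
Proof.
move=> cg ch hK gK; split; first exact: supp_conj_sub.
move=> sfh; rewrite -[x]hK; apply: (@supp_conj_sub _ _ h) => //.
by congr (supp _ _): sfh; apply/funext => y /=; rewrite !gK.
Qed.

(** Preimages of disjoint neighbourhoods of [f x] and [g x] intersect in such a [V]. As [y] and [z]
    vary independently, the case [g = id] says that [f] maps [V] off itself. *)
Lemma separate_values (S T : topologicalType) (f g : S -> T) (x : S) :
  hausdorff_space T -> continuous f -> continuous g -> f x <> g x ->
  exists V, [/\ open V, V x & forall y z, V y -> V z -> f y <> g z].
Proof.
rewrite open_hausdorff => hT cf cg /eqP/hT[[A B] /= [/set_mem fA /set_mem gB]].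
move=> [oA oB /eqP AB0]; exists (f @^-1` A `&` g @^-1` B); split=> //.
  by apply: openI; apply: open_comp.
move=> y z [Afy _] [_ Bgz] fg; suff : (A `&` B) (f y) by rewrite AB0.
by split=> //; rewrite fg.
Qed.

Lemma clopen_basis (T : topologicalType) (U : set T) (x : T) :
  boolean_space T -> open U -> U x -> exists A, [/\ clopen A, A x & A `<=` U].
Proof.
move=> [hT bT] oU Ux; have [B [cB oB Bx BU]] := bT _ _ oU Ux.
by exists B; split=> //; split=> //; exact: compact_closed.
Qed.

(* Matui's [U_t], [S_t] and [W_t] for an involution [t] of [G]. *)
Definition switchers (T : Type) (G : set (T -> T)) (t s : T -> T) : Prop :=
  [/\ G s, commutes s t, s \o s = id &
      forall a a', G a -> G a' -> a \o a' = id -> a' \o a = id ->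
        commutes a t -> commutes s (a \o s \o a')].

Definition centralizer_squares (T : Type) (G : set (T -> T)) (t b : T -> T) :
    Prop :=
  exists a, [/\ G a, b = a \o a & forall s, switchers G t s -> commutes a s].

Definition localizer (T : Type) (G : set (T -> T)) (t g : T -> T) : Prop :=
  G g /\ forall b, centralizer_squares G t b -> commutes g b.

(** * Support inclusion expressed through commutation *)

Section Localization.
Variables (T : topologicalType) (G : set (T -> T)).
Hypothesis GK : in_KF G.

Lemma KF_boolean : boolean_space T. Proof. by case: GK => -[]. Qed.

Lemma KF_hausdorff : hausdorff_space T. Proof. by case: KF_boolean. Qed.

Lemma KF_id : G id. Proof. by case: GK => -[_ []]. Qed.

Lemma KF_comp (f g : T -> T) : G f -> G g -> G (f \o g).
Proof. by case: GK => -[_ [_ + _ _]] _ _ _ _; exact. Qed.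

Lemma KF_inv (f : T -> T) :
  G f -> exists g, [/\ G g, f \o g = id & g \o f = id].
Proof. by case: GK => -[_ [_ _ + _]] _ _ _ _; exact. Qed.

Lemma KF_continuous (f : T -> T) : G f -> continuous f.
Proof. by case: GK => -[_ [_ _ _ Gh]] _ _ _ _ /Gh[]. Qed.

Lemma KF_injective (f : T -> T) : G f -> injective f.
Proof. by move=> /KF_inv[g [_ _ /compK/can_inj]]. Qed.

Lemma KF_supp_open (f : T -> T) : G f -> open (supp f).
Proof. by case: GK => -[_ _ Gh] _ _ _ /Gh[]. Qed.

Lemma KF_supp_compact (f : T -> T) : G f -> compact (supp f).
Proof. by case: GK => -[_ _ Gh] _ _ _ /Gh[]. Qed.

Lemma KF_supp_basis (U : set T) (x : T) : open U -> U x ->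
  exists a, [/\ G a, involution_nontriv a, supp a x & supp a `<=` U].
Proof.
move=> oU Ux; have [A [cA Ax AU]] := clopen_basis KF_boolean oU Ux.
case: GK => _ f1 _ _; have [a [Ga ia ax aA]] := f1 _ _ cA Ax.
by exists a; split=> //; exact: subset_trans AU.
Qed.

Lemma KF_nonsquare (U : set T) (x : T) : open U -> U x ->
  exists a, [/\ G a, (forall y, a y <> y -> U y) & a \o a <> id].
Proof.
move=> oU Ux; have [A [cA Ax AU]] := clopen_basis KF_boolean oU Ux.
case: GK => _ _ _ f3; have [a [Ga aA aa]] := f3 A cA (ex_intro _ x Ax).
by exists a; split=> // y /supp_moved/aA/AU.
Qed.

Lemma KF_partial (t : T -> T) (U : set T) (x : T) :
  G t -> involution_nontriv t -> open U -> U x -> supp t x ->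
  exists b, [/\ G b, b <> id,
    (forall y, b y <> y -> U y \/ exists2 z, U z & y = t z) &
    (forall y, b y = y \/ b y = t y)].
Proof.
move=> Gt it oU Ux tx.
have [A [cA Ax AU]] :=
  clopen_basis KF_boolean (openI oU (KF_supp_open Gt)) (conj Ux tx).
case: GK => _ _ f2 _.
have [||b [Gb bid bA bt]] := f2 t Gt it A cA.
- by exists x.
- by move=> y /AU[].
exists b; split=> // y.
  move=> /supp_moved/bA[/AU[]|[z /AU[Uz _] <-]]; first by left.
  by right; exists z.
have [by_|/nsupp_fix] := pselect (supp b y); last by left.
by right; rewrite bt.
Qed.

Variable t : T -> T.
Hypotheses (Gt : G t) (it : involution_nontriv t).

Let tt x : t (t x) = x. Proof. by case: it => _ /compK/(_ x). Qed.

(** If [s] moves [x] outside [supp t], (F3) gives [a] with [a \o a <> id] moving only points off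
    [supp t], within a neighbourhood of [x] that [s] maps off itself. Such an [a] commutes with [t],
    so [commutes_conj_square] yields a contradiction. *)
Lemma switcher_supp (s : T -> T) : switchers G t s -> supp s `<=` supp t.
Proof.
move=> [Gs st ss sC]; apply: supp_sub => x sx; apply: contrapT => ntx.
have [V [oV Vx Vs]] := @separate_values _ _ s id x KF_hausdorff
  (KF_continuous Gs) (KF_continuous KF_id) sx.
have oU := openI oV (closed_openC (closed_closure (A := [set x | t x <> x]))).
have [a [Ga aU aa]] := KF_nonsquare oU (conj Vx ntx).
have [a' [Ga' aa' a'a]] := KF_inv Ga.
apply: aa; apply: (commutes_conj_square ss aa' a'a _ aU).
  apply: sC => //; apply: commutes_disjoint.
  - exact: KF_injective.
  - exact: KF_injective.
  - move=> y; have [|/aU[_ /nsupp_fix]] := pselect (a y = y); first by left.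
    by right.
by move=> y [Vy _] [/(Vs _ _ Vy)].
Qed.

(** Involutions with values in [{x, t x}] commute pairwise, and conjugating one by an element that
    commutes with [t] gives another. *)
Lemma switcherP (s : T -> T) : G s -> s \o s = id ->
  (forall x, s x = x \/ s x = t x) -> switchers G t s.
Proof.
move=> Gs /compK ss sv.
have com r u : (forall x, r (r x) = x) -> (forall x, u (u x) = x) ->
    (forall x, r x = x \/ r x = t x) -> (forall x, u x = x \/ u x = t x) ->
    commutes r u.
  move=> rr uu rv uv; apply/commutesP => x.
  (* A map fixing [x] also fixes [t x]: otherwise it sends [t x] to [x], and being an involution
     forces [t x = x]. *)
  case: (rv x) => rx; case: (uv x) => ux; rewrite ux rx ?ux //.
  - case: (rv (t x)) => // rtx; have := rr (t x).
    by rewrite rtx tt rx.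
  - case: (uv (t x)) => [->//|utx]; have := uu (t x).
    by rewrite utx tt ux.
  - by rewrite -{1}rx rr -ux uu.
split=> //; first by apply: com => // x; right.
  exact/funext.
move=> a a' Ga Ga' /compK aa' /compK a'a /commutesP at_.
apply: com => // x /=; first by rewrite a'a ss aa'.
by case: (sv (a' x)) => ->; rewrite ?aa'; [left|right; rewrite at_ aa'].
Qed.

(** Otherwise some neighbourhood [V] of [x] has [a V] disjoint from [V] and [t V]. Since [a]
    commutes with [t], it maps the union of [V] and [t V] off itself. But (F2) gives a nontrivial
    switcher [b] moving only points of that union, and [a], commuting with [b], preserves the set of
    points [b] moves. *)
Lemma centralizer_values (a : T -> T) (x : T) :
  G a -> (forall s, switchers G t s -> commutes a s) -> supp t x ->
  a x = x \/ a x = t x.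
Proof.
move=> Ga aU tx; apply: contrapT => /not_orP[ax atx].
have ca := KF_continuous Ga.
have /commutesP at_ : commutes a t.
  by apply: aU; apply: switcherP => //; [case: it|right].
have [V1 [oV1 V1x Va]] :=
  @separate_values _ _ a id x KF_hausdorff ca (KF_continuous KF_id) ax.
have [V2 [oV2 V2x Vat]] :=
  separate_values KF_hausdorff ca (KF_continuous Gt) atx.
have [b [Gb bid bV bt]] :=
  KF_partial Gt it (openI oV1 oV2) (conj V1x V2x) tx.
set V := _ `&` V2 in bV.
have bI := KF_injective Gb.
have VV z w : V z -> V w -> a z <> w /\ a z <> t w.
  by move=> [? ?] [? ?]; split; [exact: Va|exact: Vat].
have /commutesP ab : commutes a b.
  (* [b] is an involution: if [b y = t y] and [b] fixes [t y], injectivity gives [t y = y]. *)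
  apply/aU/switcherP => //; apply/funext => y /=.
  case: (bt y) => by_; first by rewrite !by_.
  rewrite by_; case: (bt (t y)) => [bty|->//].
  by have ty : t y = y by [apply: bI; rewrite bty]; rewrite bty ty.
apply/bid/funext => y /=; apply: contrapT => by_.
have bay : b (a y) <> a y by rewrite -ab => /(KF_injective Ga).
case: (bV _ by_) (bV _ bay) => [Vy|[z Vz ->]] [Vay|[w Vw ayw]].
- by case: (VV _ _ Vy Vay).
- by case: (VV _ _ Vy Vw).
- by case: (VV _ _ Vz Vay); rewrite at_ tt.
- by case: (VV _ _ Vz Vw) => + _; apply; apply: (KF_injective Gt); rewrite -at_.
Qed.

(** If [g] moves a point off [supp t], (F3) gives [a] near it, off [supp t], with [a \o a <> id]. By
    [switcher_supp] this [a] commutes with all switchers, so [g] preserves the points moved by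
    [a \o a], yet maps them off the neighbourhood containing them. Conversely, [centralizer_values]
    makes each centralizer square trivial on [supp t]. *)
Lemma localizerE (g : T -> T) :
  localizer G t g <-> G g /\ supp g `<=` supp t.
Proof.
split=> [[Gg gS]|[Gg gt]]; split=> //.
  apply: supp_sub => x gx; apply: contrapT => ntx.
  have [V [oV Vx Vg]] := @separate_values _ _ g id x KF_hausdorff
    (KF_continuous Gg) (KF_continuous KF_id) gx.
  have oU := openI oV (closed_openC (closed_closure (A := [set x | t x <> x]))).
  have [a [Ga aU aa]] := KF_nonsquare oU (conj Vx ntx).
  have /gS/commutesP/= gaa : centralizer_squares G t (a \o a).
    exists a; split=> // s sU; have [Gs _ _ _] := sU.
    apply: commutes_disjoint; [exact: KF_injective..|] => y.
    have [|/aU[_ nty]] := pselect (a y = y); [by left|right].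
    by apply: nsupp_fix => /(switcher_supp sU).
  apply/aa/funext => y /=; apply: contrapT => aay.
  have moved z : a (a z) <> z -> V z.
    move=> aaz; have /aU[] // : a z <> z.
    by move=> az; rewrite !az in aaz.
  apply: (Vg y (g y)) => //; apply: moved => //.
  by rewrite -gaa => /(KF_injective Gg).
move=> _ [a [Ga -> aU]]; have aI := KF_injective Ga.
apply: commutes_disjoint; [exact: KF_injective|exact: inj_comp|] => y.
have [/gt ty|/nsupp_fix] := pselect (supp g y); [right=> /=|by left].
have /commutesP at_ : commutes a t.
  by apply: aU; apply: switcherP => //; [case: it|right].
case: (centralizer_values Ga aU ty) => ay; first by rewrite !ay.
by rewrite ay at_ ay tt.
Qed.

End Localization.

(** * Transport along an abstract isomorphism *)

Lemma group_iso_inverse (T1 T2 : Type) (G1 : set (T1 -> T1))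
    (G2 : set (T2 -> T2)) (Phi : (T1 -> T1) -> (T2 -> T2)) :
  (forall f g, G1 f -> G1 g -> G1 (f \o g)) -> group_iso G1 G2 Phi ->
  exists Psi, [/\ group_iso G2 G1 Psi,
    (forall g, G1 g -> Psi (Phi g) = g) & (forall h, G2 h -> Phi (Psi h) = h)].
Proof.
move=> G1M [PG PI PS PM].
have /choice[Psi PsiP] : forall h, exists g, G2 h -> G1 g /\ Phi g = h.
  move=> h; have [/PS[g Gg gh]|nG] := pselect (G2 h); first by exists g.
  (* Off [G2] the value of [Psi] is arbitrary; [id] is a default. *)
  by exists id.
have PsiK g : G1 g -> Psi (Phi g) = g.
  by move=> Gg; have [? ?] := PsiP _ (PG _ Gg); apply: PI.
exists Psi; split=> // [|h /PsiP[]//]; split.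
- by move=> h /PsiP[].
- by move=> g h /PsiP[_ {2}<-] /PsiP[_ {2}<-] ->.
- by move=> g Gg; exists (Phi g); [exact: PG|exact: PsiK].
move=> g h Gg Gh; have [Gg1 gE] := PsiP _ Gg; have [Gh1 hE] := PsiP _ Gh.
have -> : g \o h = Phi (Psi g \o Psi h) by rewrite PM // gE hE.
by apply: PsiK; exact: G1M.
Qed.

Section Transfer.
Variables (T1 T2 : topologicalType).
Variables (G1 : set (T1 -> T1)) (G2 : set (T2 -> T2)).
Variable Phi : (T1 -> T1) -> (T2 -> T2).
Hypotheses (GK1 : in_KF G1) (GK2 : in_KF G2) (iso : group_iso G1 G2 Phi).

Lemma iso_mem (g : T1 -> T1) : G1 g -> G2 (Phi g).
Proof. by case: iso => + _ _ _; exact. Qed.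

Lemma iso_inj (g h : T1 -> T1) : G1 g -> G1 h -> Phi g = Phi h -> g = h.
Proof. by case: iso => _ + _ _; exact. Qed.

Lemma iso_surj (h : T2 -> T2) : G2 h -> exists2 g, G1 g & Phi g = h.
Proof. by case: iso => _ _ + _; exact. Qed.

Lemma iso_comp (g h : T1 -> T1) :
  G1 g -> G1 h -> Phi (g \o h) = Phi g \o Phi h.
Proof. by case: iso => _ _ _; exact. Qed.

Lemma iso_id : Phi id = id.
Proof.
have G1id := KF_id GK1; apply/funext => y.
apply: (KF_injective GK2 (iso_mem G1id)).
by have /funeqP/(_ y) := esym (iso_comp G1id G1id).
Qed.

Lemma iso_commutes (g h : T1 -> T1) :
  G1 g -> G1 h -> commutes (Phi g) (Phi h) <-> commutes g h.
Proof.
move=> Gg Gh; split=> [|gh]; last by rewrite /commutes -!iso_comp // gh.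
by rewrite /commutes -!iso_comp //; apply: iso_inj; exact: KF_comp.
Qed.

Lemma iso_comp_id (g h : T1 -> T1) :
  G1 g -> G1 h -> Phi g \o Phi h = id <-> g \o h = id.
Proof.
move=> Gg Gh; rewrite -iso_comp //; split=> [|->]; last exact: iso_id.
by rewrite -iso_id; apply: iso_inj; [exact: KF_comp|exact: KF_id].
Qed.

Lemma iso_involution (t : T1 -> T1) :
  G1 t -> involution_nontriv t -> involution_nontriv (Phi t).
Proof.
move=> Gt [tid tt]; split; last exact/iso_comp_id.
by rewrite -iso_id => /(iso_inj Gt (KF_id GK1)).
Qed.

Lemma iso_switchers (t s : T1 -> T1) :
  G1 t -> switchers G1 t s -> switchers G2 (Phi t) (Phi s).
Proof.
move=> Gt [Gs st ss sC]; split.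
- exact: iso_mem.
- exact/iso_commutes.
- exact/iso_comp_id.
move=> _ _ /iso_surj[a Ga <-] /iso_surj[a' Ga' <-].
move=> /(iso_comp_id Ga Ga') aa' /(iso_comp_id Ga' Ga) a'a.
move=> /(iso_commutes Ga Gt) at_.
have Gas := KF_comp GK1 Ga Gs; rewrite -(iso_comp Ga Gs) -(iso_comp Gas Ga').
by apply/iso_commutes => //; [exact: KF_comp|exact: sC].
Qed.

(** An [a] commuting with all switchers of [Phi t] commutes in particular with the images of the
    switchers of [t], so its preimage qualifies for [t]. *)
Lemma iso_localizer (t g : T1 -> T1) :
  G1 t -> localizer G1 t g -> localizer G2 (Phi t) (Phi g).
Proof.
move=> Gt [Gg gS]; split=> [|b]; first exact: iso_mem.
move=> [_ [/iso_surj[a Ga <-] -> aU]]; rewrite -iso_comp //.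
apply/iso_commutes => //; first exact: KF_comp.
apply: gS; exists a; split=> // s sU.
have [Gs _ _ _] := sU; apply/iso_commutes => //.
exact/aU/iso_switchers.
Qed.

Lemma iso_supp_sub (t g : T1 -> T1) :
  G1 g -> G1 t -> involution_nontriv t -> supp g `<=` supp t ->
  supp (Phi g) `<=` supp (Phi t).
Proof.
move=> Gg Gt it gt.
have /(iso_localizer Gt)/localizerE[] // : localizer G1 t g.
  exact/localizerE.
- exact: iso_mem.
- exact: iso_involution.
Qed.

End Transfer.

(** * The correspondence between points *)

Definition corresponds (T1 T2 : topologicalType) (G1 : set (T1 -> T1))
    (Phi : (T1 -> T1) -> (T2 -> T2)) (x : T1) (y : T2) : Prop :=
  forall t, G1 t -> involution_nontriv t -> (supp t x <-> supp (Phi t) y).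

Section Reconstruction.
Variables (T1 T2 : topologicalType).
Variables (G1 : set (T1 -> T1)) (G2 : set (T2 -> T2)).
Variables (Phi : (T1 -> T1) -> (T2 -> T2)) (Psi : (T2 -> T2) -> (T1 -> T1)).
Hypotheses (GK1 : in_KF G1) (GK2 : in_KF G2).
Hypotheses (iso : group_iso G1 G2 Phi) (iso' : group_iso G2 G1 Psi).
Hypothesis PhiK : forall g, G1 g -> Psi (Phi g) = g.
Hypothesis PsiK : forall h, G2 h -> Phi (Psi h) = h.

(** If the images met, (F1) would place the support of an involution [s] in both, and the nonempty
    [supp (Psi s)] would lie in both [supp t] and [supp u]. *)
Lemma iso_supp_disjoint (t u : T1 -> T1) :
  G1 t -> involution_nontriv t -> G1 u -> involution_nontriv u ->
  (forall x, supp t x -> ~ supp u x) ->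
  forall y, supp (Phi t) y -> ~ supp (Phi u) y.
Proof.
move=> Gt it Gu iu tu y ty uy.
have [s [Gs is_ _ stu]] := KF_supp_basis GK2
  (openI (KF_supp_open GK2 (iso_mem iso Gt))
         (KF_supp_open GK2 (iso_mem iso Gu)))
  (conj ty uy).
have [x sx] := supp_nonempty (iso_involution GK2 GK1 iso' Gs is_).1.
have sub r : G1 r -> involution_nontriv r -> supp s `<=` supp (Phi r) ->
    supp (Psi s) `<=` supp r.
  move=> Gr ir; rewrite -{2}[r]PhiK //.
  apply: (iso_supp_sub GK2 GK1 iso') => //.
    exact: (iso_mem iso).
  exact: (iso_involution GK1 GK2 iso).
by apply: (tu x); apply: sub sx => // z /stu[].
Qed.

Lemma corresponds_exists (x : T1) : exists y, corresponds G1 Phi x y.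
Proof.
pose D := [set t | [/\ G1 t, involution_nontriv t & supp t x]].
pose F := filter_from D (fun t => supp (Phi t)).
have [t0 [Gt0 it0 t0x _]] := KF_supp_basis GK1 openT (I : setT x).
(* By (F1), two supports around [x] contain a third; [Phi] preserves these inclusions. *)
have FF : ProperFilter F.
  apply: filter_from_proper => [|t [Gt it _]].
    apply: filter_from_filter => [|t u [Gt it tx] [Gu iu ux]].
      by exists t0.
    have [s [Gs is_ sx stu]] := KF_supp_basis GK1
      (openI (KF_supp_open GK1 Gt) (KF_supp_open GK1 Gu)) (conj tx ux).
    exists s => // y sy; split;
      apply: (iso_supp_sub GK1 GK2 iso _ _ _ _ sy) => //.
      by move=> z /stu[].
    by move=> z /stu[].
  exact: (supp_nonempty (iso_involution GK1 GK2 iso Gt it).1).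
(* A cluster point exists by compactness of one image support; it lies in all of them because they
   are closed. *)
have [|y [_ Fy]] := KF_supp_compact GK2 (iso_mem iso Gt0) FF.
  by exists t0.
have xy t : G1 t -> involution_nontriv t -> supp t x -> supp (Phi t) y.
  move=> Gt it tx; apply: (@closed_closure _ [set y | Phi t y <> y]) => B By.
  by apply: Fy By; exists t.
exists y => t Gt it; split; first exact: xy.
move=> ty; apply: contrapT => ntx.
(* An involution supported around [x] and off [supp t] separates: its image support contains [y] but
   misses [supp (Phi t)]. *)
have [u [Gu iu ux ut]] := KF_supp_basis GK1
  (closed_openC (closed_closure (A := [set x | t x <> x]))) ntx.
by apply: iso_supp_disjoint (xy u Gu iu ux) ty => // z /ut.
Qed.

Lemma corresponds_sym (x : T1) (y : T2) :
  corresponds G1 Phi x y -> corresponds G2 Psi y x.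
Proof.
move=> xy t Gt it; rewrite -{1}[t]PsiK //; symmetry; apply: xy.
  exact: (iso_mem iso').
exact: (iso_involution GK2 GK1 iso').
Qed.

(** For an involution [t] with [y] in [supp t] and [supp t] inside [U], the set [supp (Psi t)]
    works. This gives both uniqueness and continuity. *)
Lemma corresponds_basis (x : T1) (y : T2) (U : set T2) :
  corresponds G1 Phi x y -> open U -> U y ->
  exists A, [/\ open A, A x &
    forall x' y', corresponds G1 Phi x' y' -> A x' -> U y'].
Proof.
move=> /corresponds_sym yx oU Uy.
have [t [Gt it ty tU]] := KF_supp_basis GK2 oU Uy.
exists (supp (Psi t)); split; first exact: (KF_supp_open GK1 (iso_mem iso' Gt)).
  exact/yx.
by move=> x' y' /corresponds_sym yx' Ax'; apply/tU/yx'.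
Qed.

Lemma corresponds_unique (x : T1) (y y' : T2) :
  corresponds G1 Phi x y -> corresponds G1 Phi x y' -> y = y'.
Proof.
move=> xy xy'; apply: contrapT => /eqP.
move: (KF_hausdorff GK2); rewrite open_hausdorff => /[apply].
move=> [[A B] /= [/set_mem Ay /set_mem By'] [oA oB /eqP AB0]].
have [V [_ Vx VA]] := corresponds_basis xy oA Ay.
suff : (A `&` B) y' by rewrite AB0.
by split=> //; exact: VA Vx.
Qed.

Lemma corresponds_continuous (phi : T1 -> T2) :
  (forall x, corresponds G1 Phi x (phi x)) -> continuous phi.
Proof.
move=> phiP x B; rewrite nbhsE => -[U [oU Ux] UB].
have [V [oV Vx VU]] := corresponds_basis (phiP x) oU Ux.
apply: filterS (open_nbhs_nbhs (conj oV Vx)) => z Vz.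
exact: UB (VU _ _ (phiP z) Vz).
Qed.

Lemma corresponds_equivariant (g : T1 -> T1) (x : T1) (y : T2) :
  G1 g -> corresponds G1 Phi x y -> corresponds G1 Phi (g x) (Phi g y).
Proof.
move=> Gg xy t Gt [tid tt]; have [h [Gh gh hg]] := KF_inv GK1 Gg.
have Ght := KF_comp GK1 Gh Gt; have Ghtg := KF_comp GK1 Ght Gg.
have hgK := compK hg; have ghK := compK gh.
have /compK PghK := (iso_comp_id GK1 GK2 iso Gg Gh).2 gh.
have /compK PhgK := (iso_comp_id GK1 GK2 iso Gh Gg).2 hg.
have PG := iso_mem iso.
have i : involution_nontriv (h \o t \o g).
  split; last first.
    by apply/funext => z /=; rewrite ghK (compK tt) hgK.
  move=> /funeqP htg; apply/tid/funext => z /=.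
  by have /= := htg (h z); rewrite !ghK => /(congr1 g); rewrite !ghK.
(* Testing [x] against the conjugate of [t] by [g] amounts to testing [g x] against [t]. *)
have := xy _ Ghtg i; rewrite (iso_comp iso Ght Gg) (iso_comp iso Gh Gt).
rewrite (supp_conj _ _ _ _ hgK ghK); [|exact: (KF_continuous GK1)..].
by rewrite (supp_conj _ _ _ _ PhgK PghK) //;
  apply: (KF_continuous GK2); exact: PG.
Qed.

End Reconstruction.

Theorem theorem6p6 (X1 X2 : topologicalType)
    (G1 : set (X1 -> X1)) (G2 : set (X2 -> X2))
    (Phi : (X1 -> X1) -> (X2 -> X2)) :
  in_KF G1 -> in_KF G2 -> group_iso G1 G2 Phi ->
  exists (phi : X1 -> X2) (psi : X2 -> X1),
    [/\ continuous phi, continuous psi, cancel phi psi, cancel psi phi &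
        forall g, G1 g -> Phi g = phi \o g \o psi].
Proof.
move=> GK1 GK2 iso.
have [Psi [iso' PhiK PsiK]] := group_iso_inverse (@KF_comp _ _ GK1) iso.
have [phi phiP] := choice (corresponds_exists GK1 GK2 iso iso' PhiK).
have [psi psiP] := choice (corresponds_exists GK2 GK1 iso' iso PsiK).
have phiK : cancel phi psi.
  (* Both [psi (phi x)] and [x] correspond to [phi x]. *)
  move=> x; apply: (corresponds_unique GK2 GK1 iso PhiK (psiP (phi x))).
  exact: (corresponds_sym GK1 GK2 iso' PsiK (phiP x)).
have psiK : cancel psi phi.
  move=> y; apply: (corresponds_unique GK1 GK2 iso' PsiK (phiP (psi y))).
  exact: (corresponds_sym GK2 GK1 iso PhiK (psiP y)).
exists phi, psi; split=> //.
- exact: (corresponds_continuous GK1 GK2 iso' PsiK).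
- exact: (corresponds_continuous GK2 GK1 iso PhiK).
(* Both sides correspond to [g (psi y)], the left one by equivariance. *)
move=> g Gg; apply/funext => y /=; rewrite -{1}[y]psiK.
apply: (corresponds_unique GK1 GK2 iso' PsiK _ (phiP _)).
exact: (corresponds_equivariant GK1 GK2 iso).
Qed.
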